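(* Let $H$ be a connected graph on $h\ge 1$ vertices with a rooted spanning tree $T$ with root $o$, let $G$ be a graph on $n\ge 1$ vertices, and let $D$ be the degree of a uniformly random vertex of $G$. Suppose a positive integer $\Delta$ and a real number $\lambda\ge 0$ satisfy $$\mathbb E\bigl[D^{h-1}\mathbf 1_{\{D\ge\Delta\}}\bigr]\le\lambda.$$ Let $s>0$ and $p\in(0,1]$, and let $N\ge1$ be an integer with $$N\ge\frac{(\Delta-1)^{2(h-1)}}{2s^2}\ln\frac2p.$$ Let $v_1^*,\dots,v_N^*$ be drawn from $V(G)$ independently and uniformly at random, and let $\widehat X_N:=\frac1N\bigl(\bar X(v_1^* )+\dots+\bar X(v_N^* )\bigr)$, with $\bar X$ as defined in the context. Then $$\mathbb P\bigl(\widehat X_N-s\le n^{-1}\operatorname{emb}(H,G)\le\widehat X_N+s+i_T\lambda\bigr)\ge1-p.$$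
   Context: Graphs are finite and simple (undirected, without loops or multiple edges). $\operatorname{Emb}(H,G)$ is the set of embeddings, i.e. injective homomorphisms (injective maps $V(H)\to V(G)$ sending adjacent vertices to adjacent vertices), and $\operatorname{emb}(H,G):=|\operatorname{Emb}(H,G)|$. For a vertex $u$, $d_u^T$ denotes its degree in $T$, and for a vertex $v$ of $G$, $d_v$ denotes its degree in $G$. A vertex $u$ of $T$ is internal if $d_u^T>1$ or $u=o$; $i_T$ is the number of internal vertices of $T$. For $v\in V(G)$, $\bar X(v)=\bar X(H,G,v,T,\Delta)$ is the number of embeddings $\sigma\in\operatorname{Emb}(H,G)$ such that $\sigma(o)=v$ and $d_{\sigma(u)}<\Delta$ for all internal vertices $u$ of $T$. Convention: $0^0=1$. *)

(* Defs.v *)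
From HB Require Import structures.
From mathcomp Require Import all_boot all_order all_algebra.
From mathcomp Require Import all_classical all_reals all_analysis.

Set Implicit Arguments.
Unset Strict Implicit.
Unset Printing Implicit Defensive.

Import Order.TTheory GRing.Theory Num.Theory.
Local Open Scope ring_scope.

Record sgraph (V : finType) := SGraph {
  adj :> rel V;
  adj_sym : symmetric adj;
  adj_irr : irreflexive adj }.

Section Graphs.
Variables (V W : finType).
Implicit Types (H T : sgraph V) (G : sgraph W) (o u : V) (Delta : nat).

Definition deg H u : nat := #|[pred w | H u w]|.

Definition connected_graph H : Prop := forall x y, connect H x y.

(* Cycles have length at least 3: a single edge traversed back and forth is a
   [ucycle] of size 2. *)
Definition acyclic_graph H : Prop :=
  forall c : seq V, (2 < size c)%N -> ~ ucycle H c.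

Definition spanning_tree H T : Prop :=
  [/\ subrel T H, connected_graph T & acyclic_graph T].

Definition internal T o u : bool := (1 < deg T u)%N || (u == o).

Definition num_internal T o : nat := #|[pred u | internal T o u]|.

End Graphs.

Section Embeddings.
Variables (V W : finType).
Implicit Types (H T : sgraph V) (G : sgraph W) (o : V) (Delta : nat).

Definition is_embedding H G (f : {ffun V -> W}) : bool :=
  injectiveb f && [forall x, forall y, H x y ==> G (f x) (f y)].

Definition emb H G : nat := #|[pred f | is_embedding H G f]|.

Definition Xbar H G T o Delta (v : W) : nat :=
  #|[pred f : {ffun V -> W} | [&& is_embedding H G f, f o == v &
      [forall u, internal T o u ==> (deg G (f u) < Delta)%N]]]|.

End Embeddings.

Section Probability.
Context {R : realType}.

Definition unif_expectation (W : finType) (f : W -> R) : R :=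
  (#|W|%:R)^-1 * \sum_(v : W) f v.

Context {d : measure_display} {Omega : measurableType d}.
Variables (P : probability Omega R) (W : finType).

(* [W] carries the discrete sigma-algebra. *)
Definition random_vertex (v : Omega -> W) : Prop :=
  forall A : {set W}, measurable [set w | v w \in A]%classic.

Definition uniform_vertex (v : Omega -> W) : Prop :=
  forall x : W, P [set w | v w = x]%classic = ((#|W|%:R)^-1)%:E.

Definition mutually_independent (I : finType) (v : I -> Omega -> W) : Prop :=
  forall (J : {set I}) (A : I -> {set W}),
    P [set w | forall i, i \in J -> v i w \in A i]%classic =
    (\prod_(i in J) P [set w | v i w \in A i]%classic)%E.

Definition iid_uniform (I : finType) (v : I -> Omega -> W) : Prop :=
  [/\ forall i, random_vertex (v i), forall i, uniform_vertex (v i)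
    & mutually_independent v].

End Probability.

Definition Xhat (R : realType) (V W : finType) (H : sgraph V) (G : sgraph W)
    (T : sgraph V) (o : V) (Delta N : nat) (v : 'I_N -> W) : R :=
  (N%:R)^-1 * \sum_(i < N) (Xbar H G T o Delta (v i))%:R.

(* Main.v *)
(** Spanning-tree exploration turns the moment condition into degree-controlled
    counts. An embedding that sends the root to a fixed vertex is determined by
    choosing, for each non-root vertex, a neighbour of its parent's image; every
    parent is internal. Hence [Xbar] lies between 0 and [(Delta - 1)^(h - 1)],
    and Hoeffding's inequality controls its empirical mean. An embedding not
    counted by [Xbar] has an internal vertex [u] whose image has maximal degree
    [d >= Delta] among internal images; rerooting the tree at [u] shows that at
    most [d^(h - 1)] embeddings share this image of [u], so these embeddings
    contribute at most [i_T * lambda] to the mean. *)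

Require Import Defs.
From HB Require Import structures.
From mathcomp Require Import all_boot all_order all_algebra.
From mathcomp Require Import all_classical all_reals all_analysis.
From mathcomp Require Import ring lra.

Import Order.TTheory GRing.Theory Num.Theory.
Import numFieldNormedType.Exports.
Local Open Scope ring_scope.

Set Implicit Arguments.
Unset Strict Implicit.
Unset Printing Implicit Defensive.

(** * Counting homomorphisms of a rooted tree with bounded degrees *)

Section TreeHoms.
Variables (V W : finType).
Implicit Types (T : sgraph V) (G : sgraph W) (o u x y : V) (f : {ffun V -> W}).

(** Take [d] to be the distance from [o]: the last-but-one vertex of a shortest walk to [u] is a
    neighbour of [u] that is strictly closer. *)
Lemma connected_dist_parent T o : connected_graph T ->
  exists d : V -> nat, forall u, u != o -> exists2 w, T w u & (d w < d u)%N.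
Proof.
move=> cT.
pose reach u k := [exists q : k.-tuple V, path T o q && (last o q == u)].
have reachP u : exists k, reach u k.
  have /connectP[q pq lq] := cT o u.
  by exists (size q); apply/existsP; exists (in_tuple q); rewrite pq lq eqxx.
exists (fun u => ex_minn (reachP u)) => u uo.
case: (ex_minnP (reachP u)) => k /existsP[[q /= /eqP sq] /andP[pq /eqP lq]] _.
case/lastP: q => [|q w] in sq pq lq *; first by rewrite -lq eqxx in uo.
move: pq lq sq; rewrite rcons_path last_rcons size_rcons => /andP[pq qw] wu <-.
exists (last o q); first by rewrite -wu.
case: ex_minnP => m _; apply.
by apply/existsP; exists (in_tuple q); rewrite pq eqxx.
Qed.

(** The parent [par u] is internal: unless it is [o], it has a neighbour with smaller [d] as well as
    the neighbour [u] with larger [d], so its degree is at least 2. *)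
Lemma connected_parent T o : connected_graph T ->
  exists (d : V -> nat) (par : V -> V), forall u, u != o ->
    [/\ T (par u) u, (d (par u) < d u)%N & internal T o (par u)].
Proof.
move=> /(@connected_dist_parent _ o)[d dP].
have parP u : exists w, (u != o) ==> (T w u && (d w < d u)%N).
  by have [->|/dP[w Tw dw]] := eqVneq u o; [exists o | exists w; rewrite Tw].
exists d, (fun u => xchoose (parP u)) => u uo.
have /implyP/(_ uo)/andP[] := xchooseP (parP u); set w := xchoose _ => Tw dw.
split=> //; rewrite /internal orbC; case: eqVneq => //= wo.
have [z Tz dz] := dP _ wo.
rewrite /deg (cardD1 u) (cardD1 z) !inE Tw adj_sym Tz.
by case: eqVneq dz => // ->; rewrite ltnNge (ltnW dw).
Qed.

(** The predicate [I] is kept separate from any root, so that the degree bound can concern the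
    vertices internal for one root while the tree is explored from another. *)
Definition bounded_hom T G (I : pred V) (B : nat) f : bool :=
  [forall x, forall y, T x y ==> G (f x) (f y)] &&
  [forall u, I u ==> (deg G (f u) <= B)%N].

(* A homomorphism fixed at the root is determined by recording, for each other
   vertex, the rank of its image among the neighbours of its parent's image. *)
Lemma card_bounded_hom T G (I : pred V) B o (w : W) :
  connected_graph T -> subpred (internal T o) I ->
  (#|[pred f | bounded_hom T G I B f & f o == w]| <= B ^ (#|V| - 1))%N.
Proof.
move=> /(@connected_parent _ o)[d [par parP]] sub_I.
pose nbrs w' := enum [pred z | G w' z].
(* The extra value in ['I_B.+1] keeps the type inhabited when [B = 0]; the root is coded by [ord0],
   and all other entries stay below [B]. *)
pose code f : {ffun V -> 'I_B.+1} :=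
  [ffun u => if u == o then ord0 else inord (index (f u) (nbrs (f (par u))))].
pose F (u : V) := [pred i : 'I_B.+1 | if u == o then i == ord0 else (i < B)%N].
have nbrsP f u : bounded_hom T G I B f -> u != o ->
    (f u \in nbrs (f (par u))) /\
    (index (f u) (nbrs (f (par u))) < B)%N.
  move=> /andP[/'forall_forallP hom /forallP bd] uo.
  have [Tu _ iu] := parP _ uo.
  have fu : f u \in nbrs (f (par u)).
    by rewrite mem_enum inE; apply: (implyP (hom _ _)).
  split=> //; rewrite -index_mem in fu; apply: leq_trans fu _.
  by rewrite -cardE; apply: (implyP (bd _)); apply: sub_I.
have code_inj :
    {in [pred f | bounded_hom T G I B f & f o == w] &, injective code}.
  move=> f g; rewrite !inE => /andP[hf /eqP fo] /andP[hg /eqP go] /ffunP e.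
  (* Decoding proceeds outwards from the root: once [f] and [g] agree at [par u], equal ranks refer
     to the same list of neighbours. *)
  apply/ffunP => u; have [k] := ubnP (d u); elim: k u => // k IH u dk.
  have [->|uo] := eqVneq u o; first by rewrite fo go.
  have [_ du _] := parP _ uo.
  have [fu fB] := nbrsP _ _ hf uo; have [gu gB] := nbrsP _ _ hg uo.
  have := congr1 val (e u); rewrite !ffunE (negPf uo) /=.
  rewrite !inordK; try exact: ltnW.
  have -> : g (par u) = f (par u) by rewrite IH // (leq_trans du).
  move=> ei; rewrite -(nth_index (f u) fu) ei nth_index //.
  by rewrite IH // (leq_trans du).
rewrite -(card_in_image code_inj).
have -> : (B ^ (#|V| - 1) = #|(family F : pred {ffun V -> 'I_B.+1})|)%N.
  rewrite card_family foldrE big_map big_enum (bigD1 o) //=.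
  have -> : #|F o| = 1%N.
    by rewrite -(card1 (@ord0 B)); apply: eq_card => i; rewrite !inE eqxx.
  rewrite mul1n.
  rewrite (eq_bigr (fun=> B)) => [|u /negPf uo].
    by rewrite prod_nat_const (cardC1 o) subn1.
  rewrite -[RHS]card_ord -(card_codom (f := widen_ord (leqnSn B))); last first.
    by move=> i j /(congr1 val) /= /val_inj.
  apply: eq_card => i; rewrite unfold_in /= uo.
  apply/idP/codomP => [iB|[j ->//]].
    by exists (Ordinal iB); apply: val_inj.
  exact: (ltn_ord j).
apply: subset_leq_card. apply/fintype.subsetP => c /fintype.imageP[f].
rewrite inE => /andP[hf _] ->; apply/familyP => u; rewrite ffunE inE.
have [uo|uo] := eqVneq u o; first by rewrite eqxx.
have [_ fB] := nbrsP _ _ hf uo.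
by rewrite inordK // ltnW.
Qed.

End TreeHoms.

(** * Hoeffding's inequality for uniform samples, in counting form *)

Section Hoeffding.
Context {R : realType}.
Implicit Types (q t b s : R).

(** By the mean value theorem [f t] is [t] times a value of [df]. Two applications in a row turn a
    sign of a second derivative into a sign of the function. *)
Lemma ge0_of_derive_ge0 (f df : R -> R) :
  (forall x : R, 0 <= x -> is_derive x 1 f (df x)) -> f 0 = 0 ->
  (forall x, 0 <= x -> 0 <= df x) -> forall t, 0 <= t -> 0 <= f t.
Proof.
move=> Df f0 df0 t t0.
have [x||c] := @MVT_segment R f df 0 t t0.
- by rewrite in_itv /= => /andP[/ltW /Df].
- apply: derivable_within_continuous => x; rewrite in_itv /= => /andP[/Df[] //].
- by rewrite in_itv /= f0 !subr0 => /andP[c0 _] ->; rewrite mulr_ge0 // df0.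
Qed.

(* The gap [g] between the exponents vanishes at [0] together with its derivative
   [g1], and [g'' >= 0] because [1/4 - r (1 - r)] is a square for the tilted
   probability [r = q e^x / D x]. *)
Lemma bernoulli_mgf_le q t : 0 <= q <= 1 -> 0 <= t ->
  1 - q + q * expR t <= expR (t ^+ 2 / 8 + q * t).
Proof.
move=> /andP[q0 q1] t0.
pose D : R -> R := cst (1 - q) + q *: expR.
have DE x : D x = 1 - q + q * expR x by [].
have D_gt0 (x : R) : 0 < D x.
  rewrite DE; have := expR_gt0 x.
  have [->|] := eqVneq q 0; first by rewrite mul0r subr0 addr0.
  move=> qn e0; apply: ltr_wpDl; first lra.
  by rewrite mulr_gt0 // lt_neqAle eq_sym qn.
have D_neq0 x : D x != 0 by rewrite gt_eqF.
have dD (x : R) : is_derive x 1 D (q * expR x).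
  have := is_deriveD (is_derive_cst (1 - q) x 1)
    (is_deriveZ q (is_derive_expR x)).
  by rewrite add0r.
pose g1 : R -> R := 4^-1 *: id + cst q - q *: (expR * (fun x => (D x)^-1)).
have g1E x : g1 x = x / 4 + q - q * (expR x / D x).
  by rewrite [x / 4]mulrC.
pose g : R -> R :=
  8^-1 *: (id : R -> R) ^+ 2 + q *: (id : R -> R) - (@ln R \o D).
have gE x : g x = x ^+ 2 / 8 + q * x - ln (D x).
  by rewrite [_ / 8]mulrC.
have g1_ge0 : forall x, 0 <= x -> 0 <= g1 x.
  apply: (@ge0_of_derive_ge0 g1
    (fun x => (D x - 2 * q * expR x) ^+ 2 / (4 * D x ^+ 2))).
  - move=> x _.
    have dV := is_deriveZ q
      (is_deriveM (is_derive_expR x) (is_deriveV (D_neq0 x) (dD x))).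
    have dp := is_deriveD (is_deriveZ 4^-1 (is_derive_id x 1))
      (is_derive_cst q x 1).
    apply: (is_derive_eq (is_deriveB dp dV)).
    rewrite /GRing.scale /=.
    by field; apply: D_neq0.
  - by rewrite g1E DE expR0 mulr1 subrK; field.
  - by move=> x _; rewrite divr_ge0 ?sqr_ge0 // mulr_ge0 // sqr_ge0.
have dg (x : R) : is_derive x 1 g (g1 x).
  have dlnD := @is_derive1_comp _ (@ln R) D x _ _
    (is_derive1_ln (D_gt0 x)) (dD x).
  have dp := is_deriveD (is_deriveZ 8^-1 (is_deriveX 2 (is_derive_id x 1)))
    (is_deriveZ q (is_derive_id x 1)).
  apply: (is_derive_eq (is_deriveB dp dlnD)).
  by rewrite g1E /GRing.scale /=; field; apply: D_neq0.
have : 0 <= g t.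
  apply: (ge0_of_derive_ge0 (fun x _ => dg x) _ g1_ge0 t0).
  by rewrite gE DE expR0 mulr1 subrK ln1; ring.
rewrite gE subr_ge0 => h.
by rewrite -[leLHS]/(D t) -(lnK (D_gt0 t)) ler_expR.
Qed.

Lemma expR_chord_le q t : 0 <= q <= 1 -> expR (q * t) <= 1 - q + q * expR t.
Proof.
(* The tangent of [expR] at [q * t] lies below the graph at [0] and at [t]. *)
move=> /andP[q0 q1].
have h0 : expR (q * t) * (1 - q * t) <= 1.
  rewrite -[leRHS]expR0 -(subrr (q * t)) expRD.
  by rewrite ler_pM2l ?expR_gt0 // expR_ge1Dx.
have h1 : expR (q * t) * (1 + (t - q * t)) <= expR t.
  rewrite -[in leRHS](subrKC (q * t) t) expRD.
  by rewrite ler_pM2l ?expR_gt0 // expR_ge1Dx.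
have := ler_wpM2l q0 h1.
have := ler_wpM2l (_ : 0 <= 1 - q) h0; rewrite subr_ge0 => /(_ q1).
nra.
Qed.

Variable W : finType.
Implicit Types Y : W -> R.

(** By convexity each [expR (t * Y x)] lies below the chord over [[0, b]]. The chord is affine in
    [Y x], so averaging leaves the moment generating function of a Bernoulli variable of parameter
    [mu / b], taken at [t * b]. *)
Lemma hoeffding_mgf_le Y b t : (0 < #|W|)%N -> 0 < b ->
  (forall x, 0 <= Y x <= b) -> 0 <= t ->
  \sum_x expR (t * Y x) <=
    #|W|%:R * expR ((t * b) ^+ 2 / 8 + t * unif_expectation Y).
Proof.
move=> W0 b0 Yb t0; set mu := unif_expectation Y.
have n0 : 0 < #|W|%:R :> R by rewrite ltr0n.
have sumY : \sum_x Y x = #|W|%:R * mu.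
  by rewrite /mu /unif_expectation mulVKf ?gt_eqF.
have mu_b : 0 <= mu / b <= 1.
  rewrite divr_ge0 ?(ltW b0) //=; last first.
    by rewrite -(pmulr_rge0 _ n0) -sumY sumr_ge0 // => x _; case/andP: (Yb x).
  rewrite ler_pdivrMr // mul1r -(ler_pM2l n0) -sumY mulr_natl -sumr_const.
  by apply: ler_sum => x _; case/andP: (Yb x).
apply: (@le_trans _ _ (\sum_x (1 - Y x / b + Y x / b * expR (t * b)))).
  apply: ler_sum => x _; have := @expR_chord_le (Y x / b) (t * b).
  rewrite [Y x / b * (t * b)]mulrCA divfK ?gt_eqF //; apply.
  by rewrite divr_ge0 ?(ltW b0) ?ler_pdivrMr ?mul1r //; case/andP: (Yb x).
rewrite big_split sumrB sumr_const -!mulr_suml sumY /=.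
rewrite -[leLHS](_ :
  #|W|%:R * (1 - mu / b + mu / b * expR (t * b)) = _); last first.
  by rewrite cardE; ring.
rewrite ler_pM2l //; apply: le_trans (bernoulli_mgf_le mu_b _) _.
  by rewrite mulr_ge0 // ltW.
by rewrite [mu / b * _]mulrCA divfK ?gt_eqF.
Qed.

(** Chernoff's method with samples counted as functions [I -> W]: an exponential dominates the
    indicator of the tail, and its sum over all samples factors. *)
Lemma hoeffding_upper_tail (I : finType) Y b s : (0 < #|W|)%N -> 0 < b ->
  (forall x, 0 <= Y x <= b) -> 0 <= s ->
  #|[pred f : {ffun I -> W} |
      #|I|%:R * (unif_expectation Y + s) <= \sum_i Y (f i)]|%:R
  <= #|W|%:R ^+ #|I| * expR (- (2 * #|I|%:R * (s / b) ^+ 2)).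
Proof.
move=> W0 b0 Yb s0; set mu := unif_expectation Y; set A := [pred f | _].
(* This [t] minimises the exponent [(t * b) ^+ 2 / 8 - t * s], with minimum [- 2 * (s / b) ^+ 2]. *)
pose t := 4 * s / b ^+ 2.
have t0 : 0 <= t by rewrite divr_ge0 ?sqr_ge0 // mulr_ge0.
apply: (@le_trans _ _ (\sum_(f : {ffun I -> W})
    expR (t * (\sum_i Y (f i) - #|I|%:R * (mu + s))))).
  rewrite -sum1_card natr_sum [leRHS](bigID (mem A)) /= -[leLHS]addr0.
  apply: lerD; last by apply: sumr_ge0 => f _; apply: expR_ge0.
  apply: ler_sum => f; rewrite inE => fA.
  by rewrite -[leLHS]expR0 ler_expR mulr_ge0 // subr_ge0.
under eq_bigr => f _ do rewrite mulrBr expRD mulr_sumr expR_sum.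
(* Independence in counting form: a sum over functions of a product is a product of sums over
   [W]. *)
rewrite -mulr_suml -(bigA_distr_bigA (fun _ x => expR (t * Y x))) prodr_const.
have /(lerXn2r #|I|) h := hoeffding_mgf_le W0 b0 Yb t0.
apply: (le_trans (ler_wpM2r (expR_ge0 _) (h _ _))).
- by rewrite nnegrE sumr_ge0 // => x _; apply: expR_ge0.
- by rewrite nnegrE mulr_ge0 // expR_ge0.
rewrite exprMn -expRM_natl -[leLHS]mulrA -expRD.
rewrite ler_wpM2l ?exprn_ge0 // ler_expR.
rewrite le_eqVlt -/mu /t; apply/orP; left; apply/eqP.
by field; rewrite gt_eqF.
Qed.

Lemma hoeffding_two_sided (I : finType) Y b s p :
  (0 < #|W|)%N -> (0 < #|I|)%N -> 0 <= b -> (forall x, 0 <= Y x <= b) ->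
  0 < s -> 0 < p -> b ^+ 2 / (2 * s ^+ 2) * ln (2 / p) <= #|I|%:R ->
  #|[pred f : {ffun I -> W} |
      s < `|#|I|%:R^-1 * \sum_i Y (f i) - unif_expectation Y|]|%:R
  <= p * #|W|%:R ^+ #|I|.
Proof.
move=> W0 I0 b0 Yb s0 p0 I_ge; set mu := unif_expectation Y.
have N0 : 0 < #|I|%:R :> R by rewrite ltr0n.
have n0 : 0 < #|W|%:R :> R by rewrite ltr0n.
(* The case [b = 0] arises for [Delta = 1] and more than one vertex in [H]. Then [Y] vanishes and no
   sample deviates; otherwise division by [b] is safe. *)
have [b_eq0|b_neq0] := eqVneq b 0.
  have Y0 x : Y x = 0 by apply/eqP; rewrite eq_le andbC -{2}b_eq0 Yb.
  rewrite eq_card0 ?mulr_ge0 ?exprn_ge0 // ?ltW // => f.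
  rewrite !inE /mu /unif_expectation !big1 => [|x _|i _]; rewrite ?Y0 //.
  by rewrite !mulr0 subr0 normr0 ltNge ltW.
have {b_neq0}b0 : 0 < b by rewrite lt_neqAle eq_sym b_neq0.
(* The lower bound on the sample size says exactly that the Hoeffding exponent is at least
   [ln (2 / p)]. *)
have tail_le : expR (- (2 * #|I|%:R * (s / b) ^+ 2)) <= p / 2.
  rewrite -[leRHS]lnK ?posrE ?divr_gt0 // ler_expR -[p / 2]invf_div.
  rewrite lnV ?posrE ?divr_gt0 // lerN2.
  have -> :
      ln (2 / p) = 2 * (b ^+ 2 / (2 * s ^+ 2) * ln (2 / p)) * (s / b) ^+ 2.
    by field; rewrite !gt_eqF.
  by rewrite ler_wpM2r ?sqr_ge0 // ler_pM2l.
have n_half : #|W|%:R ^+ #|I| * expR (- (2 * #|I|%:R * (s / b) ^+ 2)) <=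
    #|W|%:R ^+ #|I| * (p / 2) by rewrite ler_wpM2l // exprn_ge0 // ltW.
have up := le_trans (@hoeffding_upper_tail I Y b s W0 b0 Yb (ltW s0)) n_half.
(* The lower tail of [Y] is the upper tail of [b - Y], which has the same range. *)
have Yb' x : 0 <= b - Y x <= b by have := Yb x; lra.
have dn := le_trans (@hoeffding_upper_tail I _ b s W0 b0 Yb' (ltW s0)) n_half.
rewrite [p]splitr [leRHS]mulrC mulrDr.
apply: le_trans (lerD up dn); rewrite -natrD ler_nat.
rewrite -cardUI; apply: leq_trans (leq_addr _ _).
apply: subset_leq_card; apply/fintype.subsetP => f; rewrite !inE -/mu.
have -> : unif_expectation (fun x => b - Y x) = b - mu.
  rewrite /unif_expectation sumrB sumr_const mulrBr -/(unif_expectation Y).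
  by rewrite -[b *+ _]mulr_natl mulKf ?gt_eqF.
rewrite sumrB sumr_const -[b *+ _]mulr_natl lter_normr => /orP[|] h.
  by apply/orP; left; rewrite -ler_pdivlMl // addrC -lerBrDr ltW.
apply/orP; right; move: h.
rewrite opprB -(ltr_pM2l N0) mulrBr mulVKf ?gt_eqF //.
lra.
Qed.
End Hoeffding.

(** * Law of an i.i.d. uniform sample *)

Section Law.
Context {R : realType} {d : measure_display} {Omega : measurableType d}.
Variables (P : probability Omega R) (W I : finType) (v : I -> Omega -> W).
Hypothesis v_iid : iid_uniform P v.

(** This reduces probabilities to counting: the event is a finite disjoint union of atoms, one for
    each outcome in [E], and independence gives every atom the same probability. *)
Lemma iid_uniform_law (E : pred {ffun I -> W}) :
  P [set w | E [ffun i => v i w]]%classic =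
  (#|E|%:R / #|W|%:R ^+ #|I|)%:E.
Proof.
have [v_rand v_unif v_indep] := v_iid.
pose atom f : set Omega := [set w | forall i, v i w = f i]%classic.
have atom_measurable f : measurable (atom f).
  rewrite [X in measurable X](_ : _ =
    \bigcap_(i in [set: I]) [set w | v i w \in [set f i]%SET])%classic.
    by apply: fin_bigcap_measurable => // i _; exact: v_rand.
  apply/seteqP; split=> w /= vw i; first by move=> _ /=; rewrite inE vw.
  by have := vw i Logic.I; rewrite /= inE => /eqP.
have atom_prob f : P (atom f) = ((#|W|%:R ^+ #|I|)^-1)%:E.
  have := v_indep [set: I]%SET (fun i => [set f i]%SET).
  rewrite (_ : [set w | _]%classic = atom f); last first.
    apply/seteqP; split=> w /= vw i; last by rewrite !inE vw.
    by have := vw i (finset.in_setT i); rewrite inE => /eqP.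
  move=> ->.
  rewrite (eq_bigr (fun=> ((#|W|%:R)^-1)%:E)) => [|i _]; last first.
    rewrite -(v_unif i (f i)); congr (P _).
    by apply/seteqP; split=> w /=; rewrite inE => /eqP.
  by rewrite prodEFin prodr_const cardsT exprVn.
rewrite (_ : [set w | _]%classic = \bigcup_(f in [set` E]) atom f)%classic.
  have atom_triv : trivIset [set` E] atom.
    by move=> f g _ _ [w [/= wf wg]]; apply/ffunP => i; rewrite -wf wg.
  rewrite measure_fin_bigcup //.
  rewrite -(@bigfs _ _ _ _ (index_enum _)) ?index_enum_uniq //=; last first.
    by move=> f; rewrite mem_index_enum.
  under eq_bigr => f _ do rewrite atom_prob.
  by rewrite sumEFin sumr_const mulr_natl.
apply/seteqP; split=> w /= => [Ew|[f /= Ef wf]].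
  by exists [ffun i => v i w] => //= i; rewrite ffunE.
by rewrite (_ : [ffun i => v i w] = f) //; apply/ffunP => i; rewrite ffunE.
Qed.
End Law.

(** * Embeddings with low and with high internal degrees *)

Section Counting.
Variables (V W : finType) (H T : sgraph V) (G : sgraph W) (o : V) (Delta : nat).
Hypothesis T_spanning : spanning_tree H T.

Let low_degree (f : {ffun V -> W}) : bool :=
  [forall u, internal T o u ==> (deg G (f u) < Delta)%N].

Lemma embedding_tree_hom (f : {ffun V -> W}) :
  is_embedding H G f -> [forall x, forall y, T x y ==> G (f x) (f y)].
Proof.
move=> /andP[_ /'forall_forallP hom]; apply/'forall_forallP => x y.
by have [subTH _ _] := T_spanning; apply/implyP => /subTH; apply/implyP.
Qed.

Lemma Xbar_le (w : W) : (0 < Delta)%N ->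
  (Xbar H G T o Delta w <= (Delta - 1) ^ (#|V| - 1))%N.
Proof.
have [_ cT _] := T_spanning => D0.
apply: leq_trans
  (card_bounded_hom (I := internal T o) (o := o) G _ w cT _) => //.
apply: subset_leq_card; apply/fintype.subsetP => f.
rewrite inE => /and3P[/embedding_tree_hom hom fo /forallP low].
rewrite inE fo andbT /bounded_hom hom; apply/forallP => u; apply/implyP => iu.
by rewrite -ltnS subn1 prednK // (implyP (low u)).
Qed.

Lemma sum_Xbar :
  \sum_w Xbar H G T o Delta w = #|[pred f | is_embedding H G f & low_degree f]|.
Proof.
rewrite -[RHS]sum1_card.
rewrite (partition_big (fun f : {ffun V -> W} => f o) predT) //=.
apply: eq_bigr => w _; rewrite /Xbar -sum1_card; apply: eq_bigl => f.
by rewrite !inE andbA andbAC.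
Qed.

(* The internal vertex [u] whose image has maximal degree [deg (f u) >= Delta]
   bounds the degrees of all internal images, so [f] is counted by
   [card_bounded_hom] with [T] rerooted at [u]. *)
Lemma card_high_degree_embeddings :
  (#|[pred f | is_embedding H G f & ~~ low_degree f]| <=
   num_internal T o * \sum_(w | (Delta <= deg G w)%N) deg G w ^ (#|V| - 1))%N.
Proof.
have [_ cT _] := T_spanning.
pose hom u w f := bounded_hom T G (internal T o) (deg G w) f && (f u == w).
(* A union bound over pairs of an internal vertex and its image: after exchanging the sums, one
   suitable pair for each embedding suffices. *)
apply: (@leq_trans (\sum_(u | internal T o u) \sum_(w | (Delta <= deg G w)%N)
    #|[pred f | hom u w f]|)).
  rewrite pair_big /= -sum1_card.
  under [leqRHS]eq_bigr => q _ do rewrite -sum1_card big_mkcond /=.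
  rewrite exchange_big /= [leqRHS](bigID
    (fun f => is_embedding H G f && ~~ low_degree f)).
  apply: leq_trans (leq_addr _ _); apply: leq_sum => f.
  rewrite inE => /andP[/embedding_tree_hom hf].
  rewrite /low_degree negb_forall => /existsP[u0]; rewrite negb_imply -leqNgt.
  move=> /andP[iu0 du0].
  case: (arg_maxnP (fun u => deg G (f u)) iu0) => u iu u_max.
  rewrite (bigD1 (u, f u)) /=; last first.
    by rewrite iu; exact: leq_trans (u_max _ iu0).
  rewrite inE /hom eqxx andbT /bounded_hom hf.
  suff -> : [forall z, internal T o z ==> (deg G (f z) <= deg G (f u))%N] by [].
  by apply/forallP => z; apply/implyP => /u_max.
rewrite -sum_nat_const; apply: leq_sum => u iu; apply: leq_sum => w _.
(* Rerooting at [u] creates no new internal vertices, because [u] is already internal for the root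
   [o]. *)
by apply: card_bounded_hom => // z /orP[|/eqP->//]; rewrite /internal => ->.
Qed.

Lemma emb_split : emb H G = (\sum_w Xbar H G T o Delta w +
  #|[pred f | is_embedding H G f & ~~ low_degree f]|)%N.
Proof.
rewrite sum_Xbar /emb -(cardID [pred f | low_degree f]); congr addn;
  by apply: eq_card => f; rewrite !inE andbC.
Qed.

End Counting.

(** * The mean of [Xbar] compared with the normalised embedding count *)

Section Mean.
Context {R : realType}.
Variables (V W : finType) (H T : sgraph V) (G : sgraph W) (o : V) (Delta : nat).
Variable lambda : R.
Hypotheses (T_spanning : spanning_tree H T) (W_gt0 : (0 < #|W|)%N).
Hypothesis moment_le : unif_expectation (fun x : W =>
  (deg G x)%:R ^+ (#|V| - 1) * ((Delta <= deg G x)%N)%:R) <= lambda.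

(** The gap between the two means is the high-degree part of [emb_split] divided by [#|W|]; it is
    nonnegative, and the truncated moment bounds it once per internal vertex. *)
Lemma emb_mean_bounds :
  unif_expectation (fun x => (Xbar H G T o Delta x)%:R : R)
    <= (#|W|%:R)^-1 * (emb H G)%:R
    <= unif_expectation (fun x => (Xbar H G T o Delta x)%:R)
       + (num_internal T o)%:R * lambda.
Proof.
set mu := unif_expectation _; have n0 : 0 < #|W|%:R :> R by rewrite ltr0n.
rewrite (emb_split H T G o Delta) natrD natr_sum mulrDr -/mu.
rewrite lerDl mulr_ge0 ?invr_ge0 ?ler0n //= lerD2l.
apply: (@le_trans _ _ ((num_internal T o)%:R * unif_expectation (fun x : W =>
  (deg G x)%:R ^+ (#|V| - 1) * ((Delta <= deg G x)%N)%:R))); last first.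
  by rewrite ler_wpM2l.
rewrite mulrCA ler_wpM2l ?invr_ge0 ?ler0n //.
have := card_high_degree_embeddings G o Delta T_spanning.
rewrite -(ler_nat R) natrM natr_sum [in leRHS]big_mkcond /=.
under eq_bigr => w _ do rewrite natrX.
move/le_trans; apply; rewrite ler_wpM2l ?ler0n //; apply: ler_sum => w _.
by case: ifP; rewrite ?mulr1 ?mulr0.
Qed.
End Mean.

(** * Transfer of the counting estimates to the random sample *)

Theorem theorem4 (R : realType) (V W : finType) (H : sgraph V) (G : sgraph W)
  (T : sgraph V) (o : V) (h n : nat)
  (cardV : #|V| = h) (h_ge1 : (1 <= h)%N)
  (cardW : #|W| = n) (n_ge1 : (1 <= n)%N)
  (H_connected : connected_graph H) (T_spanning : spanning_tree H T)
  (Delta : nat) (Delta_gt0 : (0 < Delta)%N)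
  (lambda : R) (lambda_ge0 : 0 <= lambda)
  (moment_le : unif_expectation (fun x : W =>
      (deg G x)%:R ^+ (h - 1) * ((Delta <= deg G x)%N)%:R) <= lambda)
  (s p : R) (s_gt0 : 0 < s) (p_gt0 : 0 < p) (p_le1 : p <= 1)
  (N : nat) (N_ge1 : (1 <= N)%N)
  (N_ge : (Delta%:R - 1) ^+ (2 * (h - 1)) / (2 * s ^+ 2) * ln (2 / p)
          <= N%:R)
  (d : measure_display) (Omega : measurableType d) (P : probability Omega R)
  (v : 'I_N -> Omega -> W) (v_iid : iid_uniform P v) :
  ((1 - p)%:E <=
   P [set w | Xhat R H G T o Delta (fun i => v i w) - s
                <= (n%:R)^-1 * (emb H G)%:R
                <= Xhat R H G T o Delta (fun i => v i w) + s
                   + (num_internal T o)%:R * lambda ]%R%classic)%E.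
Proof.
subst h n.
have n0 : 0 < #|W|%:R :> R by rewrite ltr0n.
pose Y (x : W) : R := (Xbar H G T o Delta x)%:R.
pose b : R := (Delta%:R - 1) ^+ (#|V| - 1).
have b0 : 0 <= b by rewrite exprn_ge0 // subr_ge0 ler1n.
have Yb x : 0 <= Y x <= b.
  have -> : b = ((Delta - 1) ^ (#|V| - 1))%:R by rewrite natrX natrB.
  by rewrite ler0n ler_nat (Xbar_le _ _ T_spanning).
pose E : pred {ffun 'I_N -> W} := fun f =>
  Xhat R H G T o Delta f - s <= (#|W|%:R)^-1 * (emb H G)%:R
    <= Xhat R H G T o Delta f + s + (num_internal T o)%:R * lambda.
have -> : [set w | Xhat R H G T o Delta (fun i => v i w) - s
                <= (#|W|%:R)^-1 * (emb H G)%:R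
                <= Xhat R H G T o Delta (fun i => v i w) + s
                   + (num_internal T o)%:R * lambda ]%R%classic =
  [set w | E [ffun i => v i w]]%classic.
  have XhatE w : Xhat R H G T o Delta [ffun i => v i w] =
      Xhat R H G T o Delta (fun i => v i w).
    by congr (_ * _); apply: eq_bigr => i _; rewrite ffunE.
  by apply/seteqP; split=> w; rewrite /= /E XhatE.
rewrite (iid_uniform_law v_iid) lee_fin ler_pdivlMr ?exprn_gt0 //.
have := @hoeffding_two_sided R W 'I_N Y b s p n_ge1.
rewrite card_ord -exprM mulnC => /(_ N_ge1 b0 Yb s_gt0 p_gt0 N_ge) tail.
have /andP[mu_le le_mu] := emb_mean_bounds o T_spanning n_ge1 moment_le.
(* A sample whose mean is within [s] of the expectation of [Y] satisfies [E] by [mu_le] and [le_mu],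
   so every failure is a deviation counted in [tail]. *)
have notE_le : #|[predC E]|%:R <= p * #|W|%:R ^+ N.
  apply: le_trans tail; rewrite ler_nat.
  apply: subset_leq_card; apply/fintype.subsetP => f; rewrite !inE /E.
  apply: contraNT; rewrite -leNgt ler_norml -/(Xhat R H G T o Delta f).
  by move=> ?; apply/andP; split; lra.
have total : #|E|%:R + #|[predC E]|%:R = #|W|%:R ^+ N :> R.
  by rewrite -natrD cardC card_ffun card_ord natrX.
lra.
Qed.
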